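(* Let $n\geq 2$ and $m\geq 0$ be integers, let $A$ and $B^{(0)},\dots,B^{(m)}$ be $n\times n$ complex matrices, and for a complex number $b$ let $$B(b)=\sum_{s=0}^{m}B^{(s)}b^{s}.$$ Then $\det\{A+bB(b)\}$ is a polynomial function of $b$ satisfying $$\det\{A+bB(b)\}=\det\{A\}+\sum_{r=1}^{n-1}c_{r}(b)\,b^{r}+b^{n}\det\{B(b)\},$$ where $$c_{r}(b)=\sum_{\alpha,\beta\in Q_{n-r,n}}(-1)^{|\alpha|+|\beta|}\det\{A[\alpha|\beta]\}\,\det\{B(b)[\alpha^{c}|\beta^{c}]\},\quad 1\leq r\leq n-1.$$ The coefficient $c_1(b)$ satisfies $$c_{1}(b)=\mathrm{tr}\{A^{\mathrm{A}}B(b)\},$$ where $A^{\mathrm{A}}$ is the adjugate matrix of $A$. If $A$ is a diagonal matrix, then $$\mathrm{tr}\{A^{\mathrm{A}}B(b)\}=\sum_{i=1}^{n}\Big(\prod_{j\neq i}A_{j,j}\Big)B_{i,i}(b).$$ Moreover, $$\det\{A+bB(b)\}=\det\{A\}+\mathrm{tr}\{A^{\mathrm{A}}B(0)\}\,b+O(b^{2}),\quad b\rightarrow 0.$$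
   Context: For integers $1\leq r\leq n$, $Q_{r,n}=\{(i_1,\dots,i_r): 1\leq i_1<i_2<\cdots<i_r\leq n\}$. For $\alpha=(i_1,\dots,i_r)\in Q_{r,n}$, $|\alpha|=i_1+\cdots+i_r$, and $\alpha^{c}\in Q_{n-r,n}$ is the increasing sequence of the elements of $\{1,\dots,n\}\setminus\alpha$. For an $n\times n$ matrix $M$ and $\alpha,\beta\in Q_{r,n}$, $M[\alpha|\beta]$ is the $r\times r$ submatrix of $M$ with row indices from $\alpha$ and column indices from $\beta$. The adjugate is $[A^{\mathrm{A}}]_{i,j}=(-1)^{i+j}\det\{A[j^{c}|i^{c}]\}$, where $A[j^c|i^c]$ is $A$ with row $j$ and column $i$ deleted. *)

(* Defs.v *)
From HB Require Import structures.
From mathcomp Require Import all_boot all_order all_algebra.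

Set Implicit Arguments.
Unset Strict Implicit.
Unset Printing Implicit Defensive.

Import GRing.Theory.

Local Open Scope ring_scope.

Definition increasing (r n : nat) (t : r.-tuple 'I_n) : bool :=
  sorted ltn [seq val i | i <- t].

(* Indices are 0-based: i : 'I_n stands for the index i + 1 in {1, ..., n}. *)
Record incseq (r n : nat) : predArgType :=
  IncSeq { incseq_val :> r.-tuple 'I_n; _ : increasing incseq_val }.

HB.instance Definition _ (r n : nat) := [isSub for @incseq_val r n].
HB.instance Definition _ (r n : nat) := [Finite of incseq r n by <:].

(* The sum |alpha| of the indices, shifted back to 1-based values. *)
Definition weight (r n : nat) (alpha : incseq r n) : nat :=
  (\sum_(k < r) (tnth alpha k).+1)%N.

Definition compl_seq (r n : nat) (alpha : incseq r n) : seq 'I_n :=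
  [seq i <- enum 'I_n | i \notin (alpha : seq 'I_n)].

Lemma compl_size (r n : nat) (alpha : incseq r n) :
  size (compl_seq alpha) == (n - r)%N.
Proof.
case: alpha => t Ht; rewrite /compl_seq /=.
have Ut : uniq t.
  rewrite -(map_inj_uniq val_inj).
  exact: (sorted_uniq ltn_trans ltnn Ht).
have Ct : count (mem t) (enum 'I_n) = r.
  rewrite -size_filter -[RHS](size_tuple t).
  apply/perm_size/uniq_perm => //.
    by rewrite filter_uniq ?enum_uniq.
  by move=> i; rewrite mem_filter mem_enum andbT.
have := count_predC (mem t) (enum 'I_n).
by rewrite size_filter Ct size_enum_ord => E; rewrite -[X in (X - r)%N]E addKn.
Qed.

Lemma compl_increasing (r n : nat) (alpha : incseq r n) :
  increasing (Tuple (compl_size alpha)).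
Proof.
rewrite /increasing /=.
apply: (@subseq_sorted _ ltn ltn_trans _ (map val (enum 'I_n))).
  exact/map_subseq/filter_subseq.
by rewrite val_enum_ord iota_ltn_sorted.
Qed.

Definition compl (r n : nat) (alpha : incseq r n) : incseq (n - r) n :=
  IncSeq (compl_increasing alpha).

Definition minor_mx (T : Type) (r n : nat) (M : 'M[T]_n)
    (alpha beta : incseq r n) : 'M[T]_r :=
  mxsub (tnth alpha) (tnth beta) M.

Definition polymx (K : nzRingType) (n m : nat) (B : 'I_m.+1 -> 'M[K]_n) (b : K)
    : 'M[K]_n :=
  \sum_(s < m.+1) b ^+ s *: B s.

(* The complements have length n - (n - r), which equals r for r <= n. *)
Definition det_coef (K : comNzRingType) (n m : nat) (A : 'M[K]_n)
    (B : 'I_m.+1 -> 'M[K]_n) (r : nat) (b : K) : K :=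
  \sum_(alpha : incseq (n - r) n) \sum_(beta : incseq (n - r) n)
    (-1) ^+ (weight alpha + weight beta) * \det (minor_mx A alpha beta)
      * \det (minor_mx (polymx B b) (compl alpha) (compl beta)).

(* Main.v *)
(** Multilinearity in the rows writes det (X + Y) as a sum over the set S of
    rows taken from X, and sorting the permutations s by T = s @: S turns each
    summand into a sum over T of the determinant of a mixed matrix, equal to X
    on S x T, to Y on ~S x ~T and to 0 elsewhere.  Shuffling its rows and
    columns into block-diagonal form gives a product of complementary minors;
    this replaces the generalized Laplace expansion.  The expansion holds over
    any commutative ring, and applied to polynomial matrices at b = 'X it shows
    that the second-order remainder is b ^+ 2 times a polynomial. *)

Require Import Defs.
From mathcomp Require Import all_boot all_order all_algebra.
From mathcomp Require Import perm ring.

Set Implicit Arguments.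
Unset Strict Implicit.

Import Order.TTheory GRing.Theory Num.Theory.

Local Open Scope ring_scope.

(** * Expansion of [\det (X + Y)] into mixed determinants *)

Definition det_mixed {K : comNzRingType} {n : nat} (X Y : 'M[K]_n)
    (S T : {set 'I_n}) : K :=
  \det (\matrix_(i, j) (if i \in S then X i j *+ (j \in T)
                        else Y i j *+ (j \notin T))).

Lemma det_add_mixed (K : comNzRingType) (n : nat) (X Y : 'M[K]_n) :
  \det (X + Y) =
  \sum_(S : {set 'I_n}) \sum_(T : {set 'I_n} | #|T| == #|S|)
    det_mixed X Y S T.
Proof.
rewrite /det_mixed {1}/determinant.
under eq_bigr => s _.
  under eq_bigr => i _ do rewrite mxE.
  rewrite (bigA_distr 1 +%R) big_distrr /=; over.
rewrite exchange_big /=; apply: eq_big => // S _.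
rewrite exchange_big /=; apply: eq_bigr => s _.
rewrite (bigD1 (s @: S)) /=; last by rewrite card_imset //; exact: perm_inj.
rewrite [X in _ = _ + X]big1 ?addr0 => [|T /andP[/eqP cT neT]].
  congr (_ * _); apply: eq_bigr => i _.
  by rewrite mxE mem_imset; [case: (i \in S) | exact: perm_inj].
(* If [s] mapped [S] into [T], equal cardinality would force [T = s @: S]. So some row [i] of [S] is
   sent outside [T], and its factor is 0. *)
have /exists_inP[i iS siT] : [exists i in S, s i \notin T].
  apply: contraNT neT; rewrite negb_exists_in => /forall_inP sST.
  rewrite eq_sym eqEcard cT card_imset; last exact: perm_inj.
  rewrite leqnn andbT; apply/subsetP => _ /imsetP[i /sST + ->].
  by rewrite negbK.
by rewrite (bigD1 i) //= mxE iS (negbTE siT) mul0r mulr0.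
Qed.

(** * Cofactors of a diagonal matrix *)

(** A permutation never moves exactly one point, so any [s] other than 1 moves some [k != i] and its
    product contains an off-diagonal entry. Only [s = 1] survives, which forces [i = j]. *)
Lemma cofactor_diag (K : comNzRingType) (n : nat) (A : 'M[K]_n) (i j : 'I_n) :
  is_diag_mx A ->
  cofactor A i j = (\prod_(k < n | k != i) A k k) *+ (i == j).
Proof.
move=> /is_diag_mxP dA; rewrite expand_cofactor.
have zero (s : 'S_n) : s != 1%g -> s i = j ->
    \prod_(k | i != k) A k (s k) = 0.
  move=> s1 sij; have /existsP[k /andP[ik sk]] : [exists k, (i != k) && (s k != k)].
    apply: contraNT s1; rewrite negb_exists => /forallP H.
    have fixk k : i != k -> s k = k.
      by move=> ik; have := H k; rewrite ik /= negbK => /eqP.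
    apply/eqP/permP => k; rewrite perm1.
    have [<-|/fixk //] := eqVneq i k.
    have [//|] := eqVneq i (s i); move=> /fixk /perm_inj; exact.
  rewrite (bigD1 k) //= dA ?mul0r //.
  by apply: contraNneq sk => /val_inj <-.
have [eij|nij] := eqVneq i j; last first.
  apply: big1 => s /eqP sij; rewrite zero ?mulr0 //.
  by apply: contraNneq nij => s1; rewrite -sij s1 perm1.
subst j; rewrite (bigD1 (1%g : {perm _})) ?perm1 //= [X in _ + X]big1 => [|s /andP[/eqP sij s1]].
  by rewrite odd_perm1 mul1r addr0; apply: eq_big => k; rewrite 1?eq_sym ?perm1.
by rewrite zero ?mulr0.
Qed.

(** * Signs of shuffles and determinants with two blocks *)

(** Peeling off the value at [ord0] drives the induction on [n] for the sign of a shuffle. *)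
Lemma lift_perm_split (n : nat) (s : 'S_n.+1) :
  exists t : 'S_n, s = lift_perm ord0 (s ord0) t.
Proof.
have /fin_all_exists[f fE] (k : 'I_n) :
    exists j, s (lift ord0 k) = lift (s ord0) j.
  have /unlift_some[j jE _] : s ord0 != s (lift ord0 k).
    by rewrite (inj_eq perm_inj) neq_lift.
  by exists j.
have f_inj : injective f.
  move=> k l fkl; apply: (@lift_inj _ ord0); apply: (@perm_inj _ s).
  by rewrite !fE fkl.
exists (perm f_inj); apply/permP => i.
have [k ->|->] := unliftP ord0 i; last by rewrite lift_perm_id.
by rewrite lift_perm_lift permE fE.
Qed.

(* A k-shuffle has \sum_(i < k) (s i - i) inversions; the sum below has the same
   parity and avoids truncated subtraction. *)
Lemma odd_perm_increasing_blocks (n k : nat) (s : 'S_n) :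
  {in [pred i : 'I_n | (i < k)%N] &, {homo s : i j / (i < j)%N}} ->
  {in [pred i : 'I_n | (k <= i)%N] &, {homo s : i j / (i < j)%N}} ->
  odd_perm s = odd (\sum_(i < n | (i < k)%N) (s i + i)).
Proof.
elim: n k s => [|n IHn] k s.
  by move=> _ _; rewrite big_ord0; have -> : s = 1%g; [apply/permP; case | rewrite odd_perm1].
have [t sE] := lift_perm_split s; set h := s ord0 in sE.
have ltt (a b : 'I_n) : (s (lift ord0 a) < s (lift ord0 b))%N -> (t a < t b)%N.
  by rewrite sE !lift_perm_lift /= !ltnNge leq_bump2.
move=> lt_s ge_s; rewrite [in LHS]sE odd_lift_perm /= big_mkcond big_ord_recl -big_mkcond /=.
case: k => [|k] in lt_s ge_s *.
  (* Here [s] increases on all indices, so the preimage of 0 can only be 0. *)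
  have -> : h = 0%N :> nat.
    have [s0|] := eqVneq ((s^-1)%g ord0) ord0; first by rewrite /h -{1}s0 permKV.
    by rewrite -lt0n => /(ge_s ord0 _ isT isT); rewrite permKV ltn0.
  rewrite (IHn 0%N) ?big_pred0_eq // => a b _ _ ltab.
  by apply/ltt/ge_s; rewrite ?inE.
rewrite ltn0Sn addn0 oddD (IHn k).
- congr (_ (+) _).
  rewrite !(big_morph odd oddD (erefl _)); apply: eq_big => a.
    by rewrite /bump /= add1n ltnS.
  move=> ltak; have := lt_s ord0 (lift ord0 a); rewrite !inE /= => /(_ isT ltak isT).
  rewrite -/h [in (h < _)%N]sE lift_perm_lift /= => lth.
  rewrite sE lift_perm_lift /=.
  (* Since [s] increases on the first block, its later values there exceed [h]. Passing from [t] to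
     [s] thus raises index and value by one each, which keeps the parity of their sum. *)
  suff -> : bump h (t a) = (t a).+1 by rewrite /bump leq0n !oddD /= addNb addbN negbK.
  move: lth; rewrite /bump; case: (leqP h (t a)) => //= ltah.
  by rewrite add0n ltnNge (ltnW ltah).
- by move=> a b ltak ltbk ltab; apply/ltt/lt_s; rewrite ?inE.
- by move=> a b ltak ltbk ltab; apply/ltt/ge_s; rewrite ?inE.
Qed.

Lemma shuffle_perm (k l : nat) (f : 'I_k -> 'I_(k + l)) (g : 'I_l -> 'I_(k + l)) :
  {homo f : i j / (i < j)%N} -> {homo g : i j / (i < j)%N} ->
  (forall i j, f i != g j) ->
  exists p : 'S_(k + l),
    [/\ forall i, p (lshift l i) = f i, forall j, p (rshift k j) = g j
      & odd_perm p = odd (\sum_i f i + \sum_(i < k) i)].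
Proof.
move=> lt_f lt_g f_g.
have lt_inj q (u : 'I_q -> 'I_(k + l)) : {homo u : i j / (i < j)%N} -> injective u.
  move=> lt_u i j uij.
  by case: (ltngtP i j) => [/lt_u|/lt_u|/val_inj//]; rewrite uij ltnn.
pose h i := match fintype.split i with inl a => f a | inr b => g b end.
have hl a : h (lshift l a) = f a.
  by rewrite /h; have := unsplitK (inl a : 'I_k + 'I_l) => /= ->.
have hr b : h (rshift k b) = g b.
  by rewrite /h; have := unsplitK (inr b : 'I_k + 'I_l) => /= ->.
have h_inj : injective h.
  move=> i j; case: (split_ordP i) => a ->; case: (split_ordP j) => b ->.
  - by rewrite !hl => /(lt_inj _ _ lt_f)->.
  - by rewrite hl hr => /eqP; rewrite (negbTE (f_g _ _)).
  - by rewrite hl hr => /esym/eqP; rewrite (negbTE (f_g _ _)).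
  - by rewrite !hr => /(lt_inj _ _ lt_g)->.
exists (perm h_inj); split=> [i|j|]; rewrite ?permE ?hl ?hr //.
rewrite (@odd_perm_increasing_blocks _ k) => [|i j|i j]; first 1 last.
- rewrite !inE; case: (split_ordP i) => a -> //; case: (split_ordP j) => b -> //.
  by move=> _ _ /lt_f; rewrite !permE !hl.
- rewrite !inE (leqNgt k i) (leqNgt k j).
  case: (split_ordP i) => a -> //; case: (split_ordP j) => b -> //= _ _.
  by rewrite ltn_add2l => /lt_g; rewrite !permE !hr.
rewrite big_split_ord /= [X in (_ + X)%N]big_pred0 => [|j]; last first.
  by rewrite ltnNge leq_addr.
rewrite addn0 -big_split; congr odd; apply: eq_big => [i|i _] /=.
  by rewrite ltn_ord.
by rewrite permE hl.
Qed.

(** Shuffling the rows along [f], [g] and the columns along [f'], [g'] makes [N] block diagonal. The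
    equation [e] is kept as a hypothesis so that [l] can be [n - k]. *)
Lemma det_two_blocks (K : comNzRingType) (n k l : nat) (e : (k + l)%N = n)
    (f f' : 'I_k -> 'I_n) (g g' : 'I_l -> 'I_n) (N : 'M[K]_n) :
  {homo f : i j / (i < j)%N} -> {homo g : i j / (i < j)%N} ->
  {homo f' : i j / (i < j)%N} -> {homo g' : i j / (i < j)%N} ->
  (forall i j, f i != g j) -> (forall i j, f' i != g' j) ->
  (forall i j, N (f i) (g' j) = 0) -> (forall i j, N (g i) (f' j) = 0) ->
  \det N = (-1) ^+ (\sum_i f i + \sum_i f' i)
             * \det (mxsub f f' N) * \det (mxsub g g' N).
Proof.
case: n / e f f' g g' N => f f' g g' N lt_f lt_g lt_f' lt_g' f_g f'_g' N0 N0'.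
have [p [pl pr odd_p]] := shuffle_perm lt_f lt_g f_g.
have [q [ql qr odd_q]] := shuffle_perm lt_f' lt_g' f'_g'.
have blockE : row_perm p (col_perm q N)
    = block_mx (mxsub f f' N) 0 0 (mxsub g g' N).
  apply/matrixP => i j; rewrite 2![LHS]mxE.
  case: (split_ordP i) => a ->; case: (split_ordP j) => b ->;
    by rewrite ?(block_mxEul, block_mxEur, block_mxEdl, block_mxEdr) 
            ?(pl, pr, ql, qr) ?mxE ?N0 ?N0'.
have := congr1 determinant blockE.
rewrite det_ublock row_permE col_permE !det_mulmx !det_perm odd_permV -mulrA => <-.
(* Both shuffle signs contain the parity of [\sum_(i < k) i], which cancels in their product. *)
rewrite odd_p odd_q !signr_odd [_ * (_ ^+ _)]mulrC !mulrA -!exprD -signr_odd !oddD.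
by do 3!case: (odd _); rewrite mul1r.
Qed.

(** * Mixed determinants as products of complementary minors *)

Lemma tnth_incseq_homo (k n : nat) (alpha : incseq k n) :
  {homo tnth alpha : i j / (i < j)%N}.
Proof.
case: alpha => t t_incr i j ltij /=; rewrite /increasing in t_incr.
have := sorted_ltn_nth ltn_trans 0%N t_incr.
move=> /(_ i j); rewrite !inE size_map size_tuple !ltn_ord => /(_ isT isT ltij).
by rewrite !(nth_map (tnth t i)) ?size_tuple ?ltn_ord // -!tnth_nth.
Qed.

Lemma mem_compl (k n : nat) (alpha : incseq k n) (i : 'I_n) :
  (i \in (compl alpha : seq 'I_n)) = (i \notin (alpha : seq 'I_n)).
Proof. by rewrite /= mem_filter mem_enum andbT. Qed.

Definition set_of_incseq {k n : nat} (alpha : incseq k n) : {set 'I_n} :=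
  [set i in (alpha : seq 'I_n)].

Lemma det_mixed_minors (K : comNzRingType) (k n : nat) (X Y : 'M[K]_n)
    (alpha beta : incseq k n) :
  (k <= n)%N ->
  det_mixed X Y (set_of_incseq alpha) (set_of_incseq beta) =
  (-1) ^+ (weight alpha + weight beta) * \det (minor_mx X alpha beta)
    * \det (minor_mx Y (compl alpha) (compl beta)).
Proof.
move=> le_kn; rewrite /det_mixed.
have inS (gamma : incseq k n) i : tnth gamma i \in set_of_incseq gamma.
  by rewrite inE mem_tnth.
have notinS (gamma : incseq k n) j :
    (tnth (compl gamma) j \in set_of_incseq gamma) = false.
  by apply/negbTE; rewrite inE -mem_compl mem_tnth.
have disj (gamma : incseq k n) i j : tnth gamma i != tnth (compl gamma) j.
  by apply: contraFneq (notinS gamma j) => <-.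
rewrite (@det_two_blocks _ _ _ _ (subnKC le_kn) _ _ _ _ _ (@tnth_incseq_homo _ _ alpha)
  (@tnth_incseq_homo _ _ (compl alpha)) (@tnth_incseq_homo _ _ beta)
  (@tnth_incseq_homo _ _ (compl beta))) //.
- congr (_ * _); first congr (_ * _).
  (* The 1-based [weight] exceeds the 0-based sum by [k]; two such shifts leave the sign
     unchanged. *)
  + have weightE (gamma : incseq k n) : weight gamma = (\sum_i tnth gamma i + k)%N.
      rewrite /weight (eq_bigr (fun i => tnth gamma i + 1)%N) => [|i _]; last by rewrite addn1.
      by rewrite big_split /= sum1_card card_ord.
    by rewrite !weightE addnACA addnn -[in RHS]signr_odd oddD odd_double addbF signr_odd.
  + by congr (\det _); apply/matrixP => i j; rewrite !mxE !inS.
  + by congr (\det _); apply/matrixP => i j; rewrite !mxE !notinS.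
- by move=> i j; rewrite mxE inS notinS.
- by move=> i j; rewrite mxE inS notinS.
Qed.

Lemma set_of_incseq_inj (k n : nat) : injective (@set_of_incseq k n).
Proof.
move=> alpha beta /setP eqab; apply/val_inj/val_inj/(inj_map val_inj).
case: alpha beta eqab => a a_incr [b b_incr] /= eqab.
apply: (irr_sorted_eq ltn_trans ltnn) => // i.
by apply/mapP/mapP => -[j jin ->]; exists j => //; have := eqab j; rewrite !inE jin.
Qed.

Lemma card_set_of_incseq (k n : nat) (alpha : incseq k n) :
  #|set_of_incseq alpha| = k.
Proof.
rewrite cardsE; have /card_uniqP-> : uniq (alpha : seq 'I_n).
  case: alpha => t t_incr /=; rewrite -(map_inj_uniq val_inj).
  exact: (sorted_uniq ltn_trans ltnn t_incr).
exact: size_tuple.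
Qed.

Lemma set_of_incseq_surj (n : nat) (S : {set 'I_n}) :
  exists alpha : incseq #|S| n, set_of_incseq alpha = S.
Proof.
have S_size : size (enum S) == #|S| by rewrite cardE.
have S_incr : increasing (Tuple S_size).
  rewrite /increasing /= {1}/enum_mem -enumT.
  apply: (@subseq_sorted _ ltn ltn_trans _ (map val (enum 'I_n))).
    exact/map_subseq/filter_subseq.
  by rewrite val_enum_ord iota_ltn_sorted.
by exists (IncSeq S_incr); apply/setP => i; rewrite inE /= mem_enum.
Qed.

(** Increasing sequences of length [k] correspond bijectively to [k]-element subsets. *)
Lemma sum_incseq (V : nmodType) (k n : nat) (F : {set 'I_n} -> V) :
  \sum_(alpha : incseq k n) F (set_of_incseq alpha) =
  \sum_(S : {set 'I_n} | #|S| == k) F S.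
Proof.
rewrite -(big_imset _ (in2W (@set_of_incseq_inj k n))) /=.
apply: eq_bigl => S; apply/imsetP/eqP => [[alpha _ ->]|<-].
  exact: card_set_of_incseq.
by have [alpha alphaE] := set_of_incseq_surj S; exists alpha.
Qed.

(** * Homogeneous components of the expansion *)

(** The component of [\det (X + Y)] of degree [k] in [X] and, for [k <= n], of degree [n - k] in
    [Y]. *)
Definition det_level {K : comNzRingType} {n : nat} (k : nat) (X Y : 'M[K]_n) : K :=
  \sum_(S : {set 'I_n} | #|S| == k) \sum_(T : {set 'I_n} | #|T| == k)
    det_mixed X Y S T.

Lemma det_add_levels (K : comNzRingType) (n : nat) (X Y : 'M[K]_n) :
  \det (X + Y) = \sum_(k < n.+1) det_level k X Y.
Proof.
rewrite det_add_mixed.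
have card_le (S : {set 'I_n}) : (#|S| < n.+1)%N.
  by rewrite ltnS -[n in (_ <= n)%N]card_ord max_card.
rewrite (partition_big (fun S : {set 'I_n} => Ordinal (card_le S)) predT) //=.
apply: eq_bigr => k _; rewrite /det_level.
have eqk (S : {set 'I_n}) : (Ordinal (card_le S) == k) = (#|S| == k) by [].
under eq_bigl do rewrite eqk.
by apply: eq_bigr => S /eqP->.
Qed.

Lemma det_level0 (K : comNzRingType) (n : nat) (X Y : 'M[K]_n) :
  det_level 0 X Y = \det Y.
Proof.
rewrite /det_level (big_pred1 set0) => [|S]; last exact: cards_eq0.
rewrite (big_pred1 set0) => [|S]; last exact: cards_eq0.
by congr (\det _); apply/matrixP => i j; rewrite mxE !inE.
Qed.

Lemma det_leveln (K : comNzRingType) (n : nat) (X Y : 'M[K]_n) :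
  det_level n X Y = \det X.
Proof.
have full (S : {set 'I_n}) : (#|S| == n) = (S == setT).
  have := max_card (mem S); rewrite card_ord => le_Sn.
  by rewrite eqEcard subsetT cardsT card_ord eqn_leq le_Sn.
rewrite /det_level (big_pred1 setT) // (big_pred1 setT) //.
by congr (\det _); apply/matrixP => i j; rewrite mxE !inE.
Qed.

Lemma det_level_minors (K : comNzRingType) (k n : nat) (X Y : 'M[K]_n) :
  (k <= n)%N ->
  det_level k X Y = \sum_(alpha : incseq k n) \sum_(beta : incseq k n)
    (-1) ^+ (weight alpha + weight beta) * \det (minor_mx X alpha beta)
      * \det (minor_mx Y (compl alpha) (compl beta)).
Proof.
move=> le_kn; rewrite /det_level -sum_incseq; apply: eq_bigr => alpha _.
by rewrite -sum_incseq; apply: eq_bigr => beta _; rewrite det_mixed_minors.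
Qed.

Lemma det_coef_level (K : comNzRingType) (n m r : nat) (A : 'M[K]_n)
    (B : 'I_m.+1 -> 'M[K]_n) (b : K) :
  det_coef A B r b = det_level (n - r) A (polymx B b).
Proof. by rewrite det_level_minors ?leq_subr. Qed.

Lemma det_levelZ (K : comNzRingType) (k n : nat) (X Y : 'M[K]_n) (b : K) :
  (k <= n)%N -> det_level k X (b *: Y) = b ^+ (n - k) * det_level k X Y.
Proof.
move=> le_kn; rewrite !det_level_minors // big_distrr; apply: eq_bigr => alpha _.
rewrite big_distrr; apply: eq_bigr => beta _ /=.
by rewrite /minor_mx linearZ /= detZ mulrCA.
Qed.

(** The sets of size [n - 1] are the complements of single points [i] and [j]. Row [i] of the mixed
    matrix then has [Y i j] as its only possibly nonzero entry, and the cofactor there is that of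
    [X]. *)
Lemma det_level_adj (K : comNzRingType) (n : nat) (X Y : 'M[K]_n) :
  (0 < n)%N -> det_level (n - 1) X Y = \tr (\adj X *m Y).
Proof.
move=> n_gt0.
have sumC1 (F : {set 'I_n} -> K) :
    \sum_(S : {set 'I_n} | #|S| == (n - 1)%N) F S = \sum_i F [set~ i].
  have C1_inj : injective (fun i : 'I_n => [set~ i]).
    by move=> i j /setC_inj/set1_inj.
  rewrite -(big_imset _ (in2W C1_inj)) /=; apply: eq_bigl => S.
  apply/eqP/imsetP => [cS|[i _ ->]]; last by rewrite cardsC1 card_ord subn1.
  have /cards1P[i Si] : #|~: S| == 1%N.
    by rewrite cardsCs setCK card_ord cS subKn.
  by exists i; rewrite // -Si setCK.
rewrite /det_level sumC1; under eq_bigr do rewrite sumC1.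
rewrite mxtrace_mulC; apply: eq_bigr => i _; rewrite mxE; apply: eq_bigr => j _.
rewrite /det_mixed (expand_det_row _ i) (bigD1 j) //= big1 => [|k neq_kj].
  rewrite !mxE !inE !eqxx addr0; congr (_ * _); rewrite /cofactor.
  congr (_ * \det _); apply/matrixP => a c.
  by rewrite !mxE !inE !(eq_sym (lift _ _)) !neq_lift.
by rewrite !mxE !inE eqxx /= neq_kj mul0r.
Qed.

(** * Expansion in powers of [b] and the second-order remainder *)

Lemma det_add_polymx (K : comNzRingType) (n m : nat) (A : 'M[K]_n)
    (B : 'I_m.+1 -> 'M[K]_n) (b : K) :
  (1 <= n)%N ->
  \det (A + b *: polymx B b) =
  \det A + \sum_(1 <= r < n) det_coef A B r b * b ^+ r
    + b ^+ n * \det (polymx B b).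
Proof.
move=> n_gt0; rewrite det_add_levels.
rewrite -(big_mkord xpredT (fun k => det_level k A (b *: polymx B b))).
rewrite big_nat_recr //= det_leveln addrC -addrA; congr (_ + _).
rewrite (big_ltn n_gt0) det_level0 detZ addrC; congr (_ + _).
(* Level [k] carries the power [r = n - k], so the two sums run in opposite directions. *)
rewrite [RHS]big_nat_rev; apply: eq_big_nat => k /andP[k_gt0 lt_kn] /=.
rewrite det_levelZ 1?ltnW // det_coef_level mulrC add1n subSS.
by rewrite subKn 1?ltnW.
Qed.

Lemma polymx0 (K : nzRingType) (n m : nat) (B : 'I_m.+1 -> 'M[K]_n) :
  polymx B 0 = B ord0.
Proof.
rewrite /polymx big_ord_recl expr0 scale1r big1 ?addr0 // => s _.
by rewrite expr0n scale0r.
Qed.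

Lemma det_add_polymx_order2 (K : comNzRingType) (n m : nat) (A : 'M[K]_n)
    (B : 'I_m.+1 -> 'M[K]_n) (b : K) :
  (2 <= n)%N ->
  exists q : K, \det (A + b *: polymx B b) =
    \det A + \tr (\adj A *m B ord0) * b + b ^+ 2 * q.
Proof.
move=> n_ge2; have n_gt0 := ltnW n_ge2.
(* [D] is divisibility by [b ^+ 2]; it is closed under sums and holds for every term of order at
   least 2. *)
pose D x := exists q, x = b ^+ 2 * q.
have D0 : D 0 by exists 0; rewrite mulr0.
have DD x y : D x -> D y -> D (x + y).
  by move=> [p ->] [q ->]; exists (p + q); rewrite mulrDr.
have DM k x : (2 <= k)%N -> D (x * b ^+ k).
  move=> k_ge2; exists (x * b ^+ (k - 2)).
  by rewrite mulrCA -exprD subnKC.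
suff [q qE] : D (\det (A + b *: polymx B b) - (\det A + \tr (\adj A *m B ord0) * b)).
  by exists q; rewrite -qE [RHS]addrC subrK.
rewrite det_add_polymx // big_ltn // det_coef_level det_level_adj //.
(* Splitting off the constant term of [polymx B b] turns the order-1 term into the wanted trace plus
   a multiple of [b ^+ 2]. *)
have -> : polymx B b = B ord0 + b *: \sum_(s < m) b ^+ s *: B (lift ord0 s).
  rewrite /polymx big_ord_recl expr0 scale1r scaler_sumr; congr (_ + _).
  by apply: eq_bigr => s _; rewrite exprS scalerA.
set Q := \sum_(s < m) _; set c := \sum_(2 <= r < n) _.
rewrite mulmxDr linearD -scalemxAr linearZ /= mulrDl expr1.
set t := \tr _; set u := \tr _; set d := \det (_ + _).
have -> : \det A + (t * b + b * u * b + c) + b ^+ n * d - (\det A + t * b)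
    = u * b ^+ 2 + c + d * b ^+ n.
  by ring.
apply: (DD); last exact: (DM); apply: (DD); first exact: (DM).
rewrite /c big_nat_cond; apply: (big_ind D) => // r.
by rewrite andbT => /andP[r_ge2 _]; exact: (DM).
Qed.

(** Evaluation at [b] is a ring morphism, so it commutes with [\det]. This makes the determinant a
    polynomial function and transfers identities at ['X] to every [b]. *)
Lemma det_add_polymx_horner (K : comNzRingType) (n m : nat) (A : 'M[K]_n)
    (B : 'I_m.+1 -> 'M[K]_n) (b : K) :
  \det (A + b *: polymx B b) =
  (\det (map_mx polyC A + 'X *: polymx (fun s => map_mx polyC (B s)) 'X)).[b].
Proof.
rewrite -[RHS]/(horner_eval b _) -det_map_mx; congr (\det _).
apply/matrixP => i j; rewrite !mxE !summxE rmorphD rmorphM rmorph_sum /=.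
rewrite /horner_eval !hornerE; congr (_ + _ * _); apply: eq_bigr => s _.
by rewrite !mxE !hornerE.
Qed.

Lemma horner_bounded_unit (K : numFieldType) (q : {poly K}) (b : K) :
  `|b| <= 1 -> `|q.[b]| <= \sum_(i < size q) `|q`_i|.
Proof.
move=> b_le1; rewrite horner_coef (le_trans (ler_norm_sum _ _ _)) //.
apply: ler_sum => i _; rewrite normrM normrX ler_piMr // exprn_ile1 //.
Qed.

(* The complex case and the estimate as [b] tends to 0 *)
From mathcomp Require Import complex.
From mathcomp Require Import all_classical all_reals all_analysis.

Local Open Scope complex_scope.

Theorem theorem1 (R : realType) (n m : nat) (hn : (2 <= n)%N)
    (A : 'M[R[i]]_n) (B : 'I_m.+1 -> 'M[R[i]]_n) :
  (exists p : {poly R[i]}, forall b : R[i],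
      \det (A + b *: polymx B b) = p.[b]) /\
  (forall b : R[i],
      \det (A + b *: polymx B b) =
      \det A + \sum_(1 <= r < n) det_coef A B r b * b ^+ r
        + b ^+ n * \det (polymx B b)) /\
  (forall b : R[i], det_coef A B 1 b = \tr (\adj A *m polymx B b)) /\
  (is_diag_mx A -> forall b : R[i],
      \tr (\adj A *m polymx B b) =
      \sum_(i < n) (\prod_(j < n | j != i) A j j) * polymx B b i i) /\
  ((fun b : R[i] => \det (A + b *: polymx B b) : R[i]^o) =
     (fun b : R[i] => \det A + \tr (\adj A *m polymx B 0) * b : R[i]^o)
       +O_ (0 : R[i]^o) (fun b : R[i] => b ^+ 2 : R[i]^o)).
Proof.
have n_gt0 := ltnW hn; split.
  by eexists => b; exact: det_add_polymx_horner.
split; first by move=> b; exact: det_add_polymx.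
split; first by move=> b; rewrite det_coef_level det_level_adj.
split=> [dA b|].
  apply: eq_bigr => i _; rewrite mxE (bigD1 i) //= big1 => [|j neq_ji].
    by rewrite mxE cofactor_diag // eqxx addr0.
  by rewrite mxE cofactor_diag // (negbTE neq_ji) mul0r.
(* Working at ['X] yields a single polynomial [q] independent of [b]; at a number [b] the quotient
   could vary without control. *)
have [q qE] := det_add_polymx_order2 (map_mx polyC A)
  (fun s => map_mx polyC (B s)) 'X hn.
apply/eqaddOP; near=> k; near=> b.
have -> : ((fun b : R[i] => \det (A + b *: polymx B b) : R[i]^o)
    - (fun b : R[i] => \det A + \tr (\adj A *m polymx B 0) * b : R[i]^o)) b
    = b ^+ 2 * q.[b].
  rewrite !fctE det_add_polymx_horner qE polymx0 -map_mx_adj -map_mxM trace_map_mx.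
  by rewrite det_map_mx !hornerE addrAC subrr add0r.
rewrite normrM mulrC ler_wpM2r //.
(* For [b] of norm at most 1, the sum of the norms of the coefficients of [q] serves as the constant
   of the [O]. *)
apply: (@le_trans _ _ (\sum_(i < size q) `|q`_i|)).
  by apply: horner_bounded_unit; near: b; apply: (@nbhs0_le _ R[i]^o).
(* Norms take values in [R[i]], so the bound must be shown real before large [k] can dominate it. *)
by near: k; apply: nbhs_pinfty_ge; rewrite realE sumr_ge0.
Unshelve. all: by end_near.
Qed.
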